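(* Let $\mathcal{M}\subset B(\mathcal{H})$ be a unital operator space and let $\pi:C^*(\mathcal{M})\rightarrow B(\mathcal{H}_\pi)$ be a $*$-representation. Suppose that $\pi$ possesses the approximate unique extension property with respect to $\mathcal{M}$. If $\sigma:C^*(\mathcal{M})\rightarrow B(\mathcal{H}_\sigma)$ is a $*$-representation that is approximately unitarily equivalent to $\pi$, then $\sigma$ also possesses the approximate unique extension property with respect to $\mathcal{M}$.
   Context: A unital operator space is a linear subspace $\mathcal{M}\subset B(\mathcal{H})$, $\mathcal{H}$ a Hilbert space, containing the identity; $C^*(\mathcal{M})\subset B(\mathcal{H})$ is the $C^*$-algebra it generates. $*$-representations of unital $C^*$-algebras are on Hilbert spaces and are unital. A $*$-representation $\pi:C^*(\mathcal{M})\to B(\mathcal{H}_\pi)$ has the approximate unique extension property with respect to $\mathcal{M}$ if, whenever $\psi:C^*(\mathcal{M})\to B(\mathcal{H}_\pi)$ is unital completely positive with $\psi|_{\mathcal{M}}=\pi|_{\mathcal{M}}$, there is a net of unitaries $u_\beta\in B(\mathcal{H}_\pi)$ with $u_\beta^*\psi(t)u_\beta\to\pi(t)$ in the weak operator topology for every $t\in C^*(\mathcal{M})$. Two $*$-representations $\pi,\sigma$ of a $C^*$-algebra $\mathfrak{A}$ are approximately unitarily equivalent if there is a net of unitaries $u_\beta:\mathcal{H}_\sigma\to\mathcal{H}_\pi$ with $\|u_\beta^*\pi(t)u_\beta-\sigma(t)\|\to0$ for each $t\in\mathfrak{A}$. *)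

(* Defs.v *)
From HB Require Import structures.
From mathcomp Require Import all_boot all_order all_algebra sesquilinear.
From mathcomp Require Import complex.
From mathcomp Require Import boolp classical_sets functions reals.
From mathcomp Require Import topology normedtype.
From mathcomp Require Import ring lra.
Set Implicit Arguments.
Unset Strict Implicit.
Unset Printing Implicit Defensive.
Import Order.TTheory GRing.Theory Num.Theory.
Import numFieldNormedType.Exports.
Local Open Scope classical_set_scope.
Local Open Scope ring_scope.
Local Open Scope complex_scope.

(* The inner product is linear in its first argument and conjugate-linear in
   its second one; the zero space is allowed. *)
HB.mixin Record CompleteNormedModule_isHilbert (R : realType) H
    of CompleteNormedModule R[i] H := {
  inner : {dot H for @Num.conj R[i]} ;
  inner_norm : forall x : H, inner x x = `|x| ^+ 2
}.

#[short(type="hilbertType")]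
HB.structure Definition Hilbert (R : realType) :=
  {H of CompleteNormedModule_isHilbert R H & CompleteNormedModule R[i] H}.

Section BoundedOperators.
Variables (R : realType) (H K : hilbertType R).

Definition bounded_linear (f : H -> K) : Prop :=
  linear f /\ exists M : R, forall x, `|f x| <= M%:C * `|x|.

Definition bounded_linear_pred : {pred H -> K} := [pred f | `[< bounded_linear f >]].

Lemma bounded_linear_submod_closed : submod_closed bounded_linear_pred.
Proof.
split=> [|a f g].
  apply/asboolP; split; first by move=> a x y; rewrite scaler0 addr0.
  by exists 0 => x; rewrite normr0 mul0r.
move=> /asboolP[lf [M Mf]] /asboolP[lg [N Ng]]; apply/asboolP; split.
  move=> b x y; rewrite /= -[LHS]/(a *: f (b *: x + y) + g (b *: x + y)).
  rewrite lf lg -[RHS]/(b *: (a *: f x + g x) + (a *: f y + g y)).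
  rewrite !scalerDr !scalerA [b * a]mulrC -!addrA; congr (_ + _).
  by rewrite addrCA.
exists (complex.Re `|a| * M + N) => x.
rewrite -[leLHS]/(`|a *: f x + g x|) (le_trans (ler_normD _ _))//.
rewrite rmorphD mulrDl; apply: lerD; last exact: Ng.
have {1}-> : `|a *: f x| = (complex.Re `|a|)%:C * `|f x|.
  by rewrite normrZ RRe_real ?normr_real.
by rewrite rmorphM -mulrA ler_wpM2l// RRe_real ?normr_ge0 ?normr_real.
Qed.

HB.instance Definition _ :=
  GRing.isSubmodClosed.Build R[i] (H -> K) bounded_linear_pred
    bounded_linear_submod_closed.

Record bop := Bop {
  bop_fun :> H -> K;
  bop_subproof : bounded_linear_pred bop_fun }.

HB.instance Definition _ := [isSub for bop_fun].
HB.instance Definition _ := [Choice of bop by <:].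
HB.instance Definition _ := [SubChoice_isSubLmodule of bop by <:].

Definition opnorm (T : bop) : R :=
  sup [set complex.Re `|T x| | x in [set x : H | `|x| <= 1]].

End BoundedOperators.

Section Riesz.
Variables (R : realType) (H : hilbertType R).
Implicit Types x y w l : H.

Let n x : R := complex.Re `|x|.

Let nE x : (n x)%:C = `|x|.
Proof. by rewrite RRe_real// normr_real. Qed.

Let n_ge0 x : 0 <= n x.
Proof. by rewrite -lecR nE normr_ge0. Qed.

Let nD x y : n (x + y) <= n x + n y.
Proof. by rewrite -lecR rmorphD -[leRHS]/((n x)%:C + (n y)%:C) !nE ler_normD. Qed.

Let nZ (a : R) x : n (a%:C *: x) = `|a| * n x.
Proof.
apply: (@complexI R); rewrite nE normrZ rmorphM -[RHS]/(`|a|%:C * (n x)%:C) nE; congr (_ * _).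
by rewrite normc_def [complex.Re _]/= [complex.Im _]/= expr0n addr0 sqrtr_sqr. Qed.

Let parallelogram x y : n (x + y) ^+ 2 + n (x - y) ^+ 2 = 2 * (n x ^+ 2 + n y ^+ 2).
Proof.
apply: (@complexI R); rewrite rmorphM !rmorphD !rmorphXn /= !nE -!inner_norm.
rewrite hnormD hnormB /= addrACA subrr addr0 -mulr2n.
by rewrite -[1%:C]/(1 : R[i]) [RHS]mulrDl mul1r mulr2n.
Qed.

Lemma Riesz_representation (g : H -> R[i]) (M : R) :
    (forall a x y, g (a *: x + y) = a * g x + g y) ->
    (forall x, `|g x| <= M%:C * `|x|) ->
  exists z, forall x, g x = inner x z.
Proof.
move=> glin gM.
have g0 : g 0 = 0.
  by apply/eqP; rewrite -normr_le0 (le_trans (gM 0))// normr0 mulr0.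
have gD x y : g (x + y) = g x + g y by rewrite -[x]scale1r glin mul1r scale1r.
have gZ a x : g (a *: x) = a * g x by rewrite -[_ *: _]addr0 glin g0 addr0.
have gB x y : g (x - y) = g x - g y by rewrite gD -scaleN1r gZ mulN1r.
have [[x1 gx1]|] := pselect (exists x, g x != 0); last first.
  move=> /forallNP g_eq0; exists 0 => x; rewrite linear0r.
  by apply/eqP/negPn/negP; exact: g_eq0.
pose D := [set n x | x in [set x | g x = 1]].
have D_inf : has_inf D.
  split; last by exists 0 => _ [x _ <-].
  exists (n ((g x1)^-1 *: x1)); exists ((g x1)^-1 *: x1) => //=.
  by rewrite gZ mulVf.
pose d := inf D.
have d_ge0 : 0 <= d by apply: lb_le_inf; [exact: D_inf.1|move=> _ [x _ <-]].
have dn x : g x = 1 -> d <= n x by move=> gx; apply: (ge_inf D_inf.2); exists x.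
pose B (e : R) := [set x | g x = 1 /\ n x < d + e].
pose F := filter_from [set e : R | 0 < e] B.
have B0 (e : R) : 0 < e -> B e !=set0.
  by move=> /inf_adherent /(_ D_inf)[_ [x gx <-] nx]; exists x.
have FF : ProperFilter F.
  apply: filter_from_proper; last by move=> e /=; exact: B0.
  apply: filter_from_filter; first by exists 1 => /=.
  move=> i j /= i0 j0; exists (Num.min i j) => /=; first by rewrite lt_min i0.
  move=> x [gx nx]; split; split=> //; apply: (lt_le_trans nx);
    by rewrite lerD2l ge_min lexx ?orbT.
have close (e : R) : 0 < e -> exists2 t : R, 0 < t &
    forall x y, B t x -> B t y -> n (x - y) < e.
  move=> e0.
  have c0 : 0 < 8 * d + 8 by rewrite ltr_wpDl// mulr_ge0.
  exists (Num.min 1 (e ^+ 2 / (8 * d + 8))).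
    by rewrite lt_min ltr01/= divr_gt0// exprn_gt0.
  set t := Num.min _ _.
  have t0 : 0 < t by rewrite lt_min ltr01/= divr_gt0// exprn_gt0.
  have t1 : t <= 1 by rewrite ge_min lexx.
  have te : t * (8 * d + 8) <= e ^+ 2 by rewrite -ler_pdivlMr// ge_min lexx orbT.
  move=> x y [gx nx] [gy ny].
  have mid : 2 * d <= n (x + y).
    have -> : n (x + y) = 2 * n ((2^-1)%:C *: (x + y)).
      by rewrite nZ ger0_norm ?invr_ge0// mulrA divff ?mul1r// pnatr_eq0.
    rewrite ler_pM2l// dn// gZ gD gx gy -(rmorph1 (real_complex R)) -rmorphD -rmorphM /=.
    by rewrite mulVf// pnatr_eq0.
  rewrite -(@ltr_pXn2r _ 2)// ?nnegrE// ?(ltW e0)//.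
  have := parallelogram x y; move: (n_ge0 x) (n_ge0 y).
  move: mid nx ny => /=; move: (n (x + y)) (n x) (n y) (n (x - y)) => a b b' c.
  move=> mid nb nb' b0 b0' par.
  have a2 : (2 * d) ^+ 2 <= a ^+ 2 by rewrite ler_pXn2r ?nnegrE ?mulr_ge0// (le_trans _ mid)// mulr_ge0.
  have b2 : b ^+ 2 <= (d + t) ^+ 2 by rewrite ler_pXn2r ?nnegrE ?addr_ge0 ?(ltW t0)// ltW.
  have b2' : b' ^+ 2 <= (d + t) ^+ 2 by rewrite ler_pXn2r ?nnegrE ?addr_ge0 ?(ltW t0)// ltW.
  nra.
have Fcauchy : cauchy F.
  apply/cauchy_ballP => e e0.
  have er : (complex.Re e)%:C = e by rewrite RRe_real// gtr0_real.
  have [|t t0 tB] := close (complex.Re e); first by rewrite -ltcR er.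
  exists (B t, B t); first by split; exists t.
  move=> [x y] [/= Bx By]; rewrite -ball_normE /ball_ /=.
  by rewrite -er -nE ltcR tB.
have /cvg_ex[l Fl] : cvg F by exact: cauchy_cvg.
have near_l (e : R) : 0 < e -> exists x, B e x /\ n (l - x) < e.
  move=> e0.
  have Fe : F (B e) by exists e.
  have Fb : F (ball l e%:C).
    by apply: Fl; apply: nbhsx_ballx; rewrite ltcR.
  have [x [Bx]] := filter_ex (filterI Fe Fb).
  rewrite -ball_normE /ball_ /= -nE ltcR => lx.
  by exists x.
have gl : g l = 1.
  apply/eqP; rewrite -subr_eq0 -normr_le0.
  have -> : `|g l - 1| = (complex.Re `|g l - 1|)%:C by rewrite RRe_real// normr_real.
  rewrite lecR; apply/ler_addgt0Pr => e e0; rewrite add0r.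
  have M0 : 0 < `|M| + 1 by rewrite ltr_wpDl.
  have [|x [[gx nx] lx]] := near_l (e / (`|M| + 1)); first by rewrite divr_gt0.
  rewrite -lecR RRe_real ?normr_real// -gx -gB (le_trans (gM _))// -nE -rmorphM lecR.
  rewrite (le_trans (ler_wpM2r (n_ge0 _) (ler_norm M)))//.
  rewrite (@le_trans _ _ ((`|M| + 1) * n (l - x)))//.
    by rewrite ler_wpM2r// lerDl.
  by rewrite mulrC -ler_pdivlMr// ltW.
have nl : n l <= d.
  apply/ler_addgt0Pr => e e0.
  have [|x [[_ nx] lx]] := near_l (e / 2); first by rewrite divr_gt0.
  rewrite -[l](subrK x) (le_trans (nD _ _))// [e]splitr addrA addrC.
  by rewrite lerD// ltW.
have orth w : g w = 0 -> inner w l = 0.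
  move=> gw; have [->|w0] := eqVneq w 0; first by rewrite linear0l.
  have ww0 : inner w w != 0 by rewrite dnorm_eq0.
  pose t := inner l w / inner w w; pose u := l - t *: w.
  have uw : inner u (t *: w) = 0.
    rewrite linearZr_LR /= /u linearBl /= linearZl_LR /= /t divfK//.
    by rewrite subrr mulr0.
  have lu : inner l l <= inner u u.
    rewrite !inner_norm -!nE -!rmorphXn lecR ler_pXn2r ?nnegrE//.
    by rewrite (le_trans nl)// dn// /u gB gZ gw mulr0 subr0.
  have : inner (t *: w) (t *: w) <= 0.
    rewrite -(lerD2l (inner u u)) addr0 -hnormDd//.
    by rewrite /u subrK.
  rewrite le_eqVlt => /orP[|/lt_geF]; last by rewrite dnorm_ge0.
  rewrite dnorm_eq0 scaler_eq0 (negPf w0) orbF.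
  rewrite /t mulf_eq0 invr_eq0 (negPf ww0) orbF => /eqP lw.
  by apply/eqP; rewrite herm_eq0C; apply/eqP; exact: lw.
have ll0 : inner l l != 0.
  rewrite dnorm_eq0; apply/eqP => l0; move: gl; rewrite l0 g0 => /eqP.
  by rewrite eq_sym oner_eq0.
exists (Num.conj (inner l l)^-1 *: l) => x.
have : inner (x - g x *: l) l = 0 by apply: orth; rewrite gB gZ gl mulr1 subrr.
rewrite linearBl /= linearZl_LR /= => /eqP; rewrite subr_eq0 => /eqP xl.
rewrite linearZr_LR /= xl.
by rewrite  -[LHS](mulfK ll0) mulrC; congr (_ * _); exact/esym/conjCK.
Qed.

End Riesz.

Section InnerProduct.
Variables (R : realType) (H : hilbertType R).

Lemma inner_ext (x y : H) : (forall z, inner z x = inner z y) -> x = y.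
Proof.
move=> xy; apply/eqP; rewrite -subr_eq0 -(dnorm_eq0 inner) linearBr /=.
by rewrite xy subrr.
Qed.

Lemma Cauchy_Schwarz (x y : H) : `|inner x y| <= `|x| * `|y|.
Proof.
have [->|y0] := eqVneq y 0; first by rewrite linear0r !normr0 mulr0.
have yy0 : inner y y != 0 by rewrite dnorm_eq0.
pose t := inner x y / inner y y; pose u := x - t *: y.
have uy : inner u (t *: y) = 0.
  by rewrite linearZr_LR /= /u linearBl /= linearZl_LR /= /t divfK// subrr mulr0.
have : inner (t *: y) (t *: y) <= inner x x.
  by rewrite -[x in leRHS](subrK (t *: y)) -/u hnormDd// lerDr dnorm_ge0.
rewrite !inner_norm ler_pXn2r ?nnegrE// normrZ normrM normfV inner_norm.
rewrite normrX normr_id => tx; rewrite -(ler_pM2r (_ : 0 < `|y|^-1)) ?invr_gt0 ?normr_gt0//.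
rewrite mulfK ?normr_eq0// (le_trans _ tx)// expr2 invfM -!mulrA mulVf ?normr_eq0//.
by rewrite mulr1.
Qed.

End InnerProduct.

Section Adjoint.
Variables (R : realType) (H K : hilbertType R).

Lemma adjoint_exists (T : bop H K) :
  exists S : bop K H, forall x y, inner (T x) y = inner x (S y).
Proof.
case: T => T /asboolP[linT [M TM]] /=.
have /choice[S SE] y : exists z, forall x, inner (T x) y = inner x z.
  apply: (@Riesz_representation _ _ (fun x => inner (T x) y)
    (complex.Re `|y| * M)) => [a x x'|x].
    by rewrite linT linearDl /= linearZl_LR.
  rewrite (le_trans (Cauchy_Schwarz _ _))// rmorphM.
  rewrite -[leRHS]/((complex.Re `|y|)%:C * M%:C * `|x|) RRe_real ?normr_real//.
  by rewrite mulrC -mulrA ler_wpM2l.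
suff bS : bounded_linear_pred S by exists (Bop bS).
apply/asboolP; split=> [a y y'|].
  apply: inner_ext => x.
  by rewrite -SE !linearDr /= !linearZr_LR /= !SE.
exists `|M| => y; have [->|Sy0] := eqVneq (S y) 0.
  by rewrite normr0 mulr_ge0// lecR.
rewrite -(@ler_pM2r _ `|S y|) ?normr_gt0// -expr2 -inner_norm -SE.
rewrite (le_trans (real_ler_norm _)) ?ger0_real ?SE ?dnorm_ge0// -SE.
rewrite (le_trans (Cauchy_Schwarz _ _))// mulrAC ler_wpM2r//.
by rewrite (le_trans (TM _))// ler_wpM2r// lecR ler_norm.
Qed.

Definition adj (T : bop H K) : bop K H := projT1 (cid (adjoint_exists T)).

Lemma adjE (T : bop H K) x y : inner (T x) y = inner x (adj T y).
Proof. exact: (projT2 (cid (adjoint_exists T))). Qed.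

End Adjoint.

Section Composition.
Variables (R : realType).

Lemma bid_subproof (H : hilbertType R) : @bounded_linear_pred R H H id.
Proof. by apply/asboolP; split=> //; exists 1 => x; rewrite mul1r. Qed.

Definition bid (H : hilbertType R) : bop H H := Bop (bid_subproof H).

Lemma bcomp_subproof (H K L : hilbertType R) (S : bop K L) (T : bop H K) :
  bounded_linear_pred (S \o T).
Proof.
case: S T => [S /asboolP[lS [M SM]]] [T /asboolP[lT [N TN]]] /=.
apply/asboolP; split=> [a x y|]; first by rewrite /= lT lS.
exists (`|M| * N) => x /=.
rewrite (le_trans (SM _))// (@le_trans _ _ (`|M|%:C * `|T x|))//.
  by rewrite ler_wpM2r// lecR ler_norm.
by rewrite rmorphM -mulrA ler_wpM2l// lecR.
Qed.

Definition bcomp (H K L : hilbertType R) (S : bop K L) (T : bop H K) : bop H L :=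
  Bop (bcomp_subproof S T).

End Composition.

Arguments bid {R} H.

Notation "''B' ( H )" := (bop H H) (at level 0, format "''B' ( H )") : type_scope.
Notation "S *o T" := (bcomp S T) (at level 40, left associativity) : ring_scope.

Section Nets.

Definition directed (I : Type) (le : I -> I -> Prop) : Prop :=
  [/\ inhabited I,
      forall i, le i i,
      forall i j k, le i j -> le j k -> le i k &
      forall i j, exists2 k, le i k & le j k].

(* [f @ tails le --> l] is the convergence of the net [f] along [le]. *)
Definition tails (I : Type) (le : I -> I -> Prop) : set_system I :=
  [set P | exists i, forall j, le i j -> P j].

Variables (R : realType) (H K : hilbertType R).
Variables (I : Type) (le : I -> I -> Prop).

Definition wot_cvg (T : I -> bop H K) (S : bop H K) : Prop :=
  forall x y,
    (inner (T i x) y : R[i]^o) @[i --> tails le] --> (inner (S x) y : R[i]^o).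

Definition norm_cvg (T : I -> bop H K) (S : bop H K) : Prop :=
  opnorm (T i - S) @[i --> tails le] --> (0 : R).

End Nets.

Section OperatorSpaces.
Variables (R : realType) (H : hilbertType R).

Definition unital_operator_space (M : set 'B(H)) : Prop :=
  M (bid H) /\ forall (a : R[i]) S T, M S -> M T -> M (a *: S + T).

Definition cstar_subalgebra (A : set 'B(H)) : Prop :=
  [/\ A 0 /\ forall (a : R[i]) S T, A S -> A T -> A (a *: S + T),
      forall S T, A S -> A T -> A (S *o T),
      forall T, A T -> A (adj T) &
      forall T, (forall e : R, 0 < e -> exists2 S, A S & opnorm (T - S) < e) ->
        A T].

Definition cstar (M : set 'B(H)) : set 'B(H) := smallest cstar_subalgebra M.

(* Positivity of a matrix of operators, acting as a single operator on H^n;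
   [0 <= z] in R[i] says that z is real and nonnegative. *)
Definition mx_positive (n : nat) (a : 'M['B(H)]_n) : Prop :=
  forall x : 'I_n -> H, 0 <= \sum_(i < n) \sum_(j < n) inner (a i j (x j)) (x i).

End OperatorSpaces.

(* A map defined on a C*-algebra [A] of operators is encoded by a total function
   on B(H) of which only the values on [A] matter: no predicate below looks at
   the values outside [A] (which is meant to contain the identity). *)
Section Maps.
Variables (R : realType) (H K : hilbertType R) (A : set 'B(H)).

Definition linear_on (f : 'B(H) -> 'B(K)) : Prop :=
  forall (a : R[i]) S T, A S -> A T -> f (a *: S + T) = a *: f S + f T.

Definition star_representation (f : 'B(H) -> 'B(K)) : Prop :=
  [/\ linear_on f,
      forall S T, A S -> A T -> f (S *o T) = f S *o f T,
      forall T, A T -> f (adj T) = adj (f T) &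
      f (bid H) = bid K].

Definition completely_positive (f : 'B(H) -> 'B(K)) : Prop :=
  forall (n : nat) (a : 'M['B(H)]_n),
    (forall i j, A (a i j)) -> mx_positive a -> mx_positive (map_mx f a).

Definition ucp (f : 'B(H) -> 'B(K)) : Prop :=
  [/\ linear_on f, completely_positive f & f (bid H) = bid K].

End Maps.

Section Definitions.
Variables (R : realType).

Definition unitary (H K : hilbertType R) (u : bop H K) : Prop :=
  adj u *o u = bid H /\ u *o adj u = bid K.

Definition approx_unique_extension (H K : hilbertType R) (M : set 'B(H))
    (pi : 'B(H) -> 'B(K)) : Prop :=
  forall psi : 'B(H) -> 'B(K), ucp (cstar M) psi ->
    (forall T, M T -> psi T = pi T) ->
  exists (I : Type) (le : I -> I -> Prop) (u : I -> 'B(K)),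
    [/\ directed le, forall i, unitary (u i) &
        forall T, cstar M T ->
          wot_cvg le (fun i => adj (u i) *o psi T *o u i) (pi T)].

Definition approx_unitarily_equivalent (H K L : hilbertType R) (A : set 'B(H))
    (pi : 'B(H) -> 'B(K)) (sigma : 'B(H) -> 'B(L)) : Prop :=
  exists (I : Type) (le : I -> I -> Prop) (u : I -> bop L K),
    [/\ directed le, forall i, unitary (u i) &
        forall T, A T ->
          norm_cvg le (fun i => adj (u i) *o pi T *o u i) (sigma T)].

End Definitions.

(* Main.v *)
(* The representation [sigma] has the property as soon as it lies in the closure
   of the unitary orbit of every ucp extension [psi] of its restriction to [M],
   for the topology of pointwise WOT-convergence. Conjugating [psi] by the
   unitaries [u i] that carry [sigma] to [pi] and passing to the limit along an
   ultrafilter gives a ucp map [phi] on the space of [pi]; since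
   [u i *o sigma T *o adj (u i)] tends to [pi T] in norm, [phi] agrees with [pi]
   on [M]. So [sigma] is in the orbit closure of [pi], [pi] in that of [phi] by
   hypothesis, and [phi] in that of [psi] by construction. This relation is
   transitive. *)
Require Import Defs.
From mathcomp Require Import all_boot all_order all_algebra.
From mathcomp Require Import classical_sets reals.
From mathcomp Require Import sesquilinear complex boolp functions.
From mathcomp Require Import topology normedtype.
Set Implicit Arguments.
Unset Strict Implicit.
Unset Printing Implicit Defensive.
Import Order.TTheory GRing.Theory Num.Theory.
Import numFieldNormedType.Exports.
Local Open Scope classical_set_scope.
Local Open Scope ring_scope.
Local Open Scope complex_scope.

(** * Ultrafilters, and the filter of tails of a net *)

Lemma ultra_fmap (I T : Type) (f : I -> T) (F : set_system I) :
  UltraFilter F -> UltraFilter (f @ F).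
Proof.
move=> UF; split=> [|G PG FG]; first exact: fmap_proper_filter.
apply/predeqP => A; split=> [GA|]; last exact: FG.
have [//|FnA] := in_ultra_setVsetC (f @^-1` A) UF.
have GnA : G (~` A) by apply: FG.
by have [x []] := filter_ex (filterI GA GnA).
Qed.

Lemma filter_near_seq (I : Type) (F : set_system I) (T : eqType) (s : seq T)
    (P : T -> I -> Prop) : Filter F ->
  (forall z, z \in s -> \forall i \near F, P z i) ->
  \forall i \near F, forall z, z \in s -> P z i.
Proof.
move=> FF; elim: s => [|z s IH] sP; first by near=> i.
have Ps : \forall i \near F, forall z', z' \in s -> P z' i.
  by apply: IH => z' sz'; apply: sP; rewrite inE sz' orbT.
have Pz : \forall i \near F, P z i by apply: sP; rewrite inE eqxx.
near=> i => z'; rewrite inE => /predU1P[->|]; first by near: i.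
by move: z'; near: i.
Unshelve. all: by end_near. Qed.

Lemma tails_proper_filter (I : Type) (le : I -> I -> Prop) :
  directed le -> ProperFilter (tails le).
Proof.
move=> [[i0] lexx letr ledir]; split; first by move=> [i /(_ i (lexx i))].
split; first by exists i0.
- move=> P Q [i iP] [j jQ]; have [k ik jk] := ledir i j.
  exists k => l kl; split; first by apply: iP; exact: letr kl.
  by apply: jQ; exact: letr kl.
- by move=> P Q PQ [i iP]; exists i => j /iP /PQ.
Qed.

(** * Limits of complex-valued families along a filter *)

Lemma normc_ge_Im (R : realType) (x : R[i]) : `|complex.Im x|%:C <= `|x|.
Proof. by rewrite normc_def lecR -sqrtr_sqr ler_wsqrtr// lerDr sqr_ge0. Qed.

Section ComplexLimits.
Variables (R : realType) (I : Type) (F : set_system I).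

Lemma cvg_complex_unique {FF : ProperFilter F} (z : I -> R[i]^o) (l l' : R[i]^o) :
  z i @[i --> F] --> l -> z i @[i --> F] --> l' -> l = l'.
Proof. by apply: cvg_unique; exact: norm_hausdorff. Qed.

(** Turns operator norm convergence, a limit in [R], into convergence of matrix coefficients in
    [R[i]]; there [c] is a product of two vector norms. *)
Lemma cvg_dist_real {FF : Filter F} (a : I -> R) (z : I -> R[i]^o) (l c : R[i]) :
  0 <= c -> (forall i, `|l - z i| <= (a i)%:C * c) -> a i @[i --> F] --> (0 : R) ->
  z i @[i --> F] --> (l : R[i]^o).
Proof.
move=> c0 zl a0; apply/cvgrPdist_lt => e e0.
(* Dividing by [c + 1] instead of [c] covers the case [c = 0]. *)
have c10 : 0 < c + 1 by rewrite ltr_wpDl.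
have er : ((complex.Re (e / (c + 1)))%:C = e / (c + 1)).
  by rewrite RRe_real// gtr0_real// divr_gt0.
have d0 : 0 < complex.Re (e / (c + 1)) by rewrite -ltcR er divr_gt0.
move/cvgrPdist_lt: a0 => /(_ _ d0); apply: filterS => i.
rewrite sub0r normrN -ltcR er ltr_pdivlMr// => ai.
rewrite (le_lt_trans (zl i))// (le_lt_trans _ ai)//.
apply: (@le_trans _ _ (`|a i|%:C * c)); first by rewrite ler_wpM2r// lecR ler_norm.
by rewrite ler_wpM2l ?lecR// lerDl.
Qed.

Lemma cvg_real_complex {FF : Filter F} (a : I -> R) (l : R) :
  a i @[i --> F] --> l -> ((a i)%:C : R[i]^o) @[i --> F] --> (l%:C : R[i]^o).
Proof.
move=> al; apply: (@cvg_dist_real _ (fun i => `|l - a i|) _ _ 1) => // [i|].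
  by rewrite mulr1 -rmorphB /= normc_def /= expr0n addr0 sqrtr_sqr.
rewrite -(normr0 R^o); apply: (@cvg_norm _ R^o).
by rewrite -(subrr l); apply: cvgB => //; exact: cvg_cst.
Qed.

(** Real and imaginary parts stay in the compact segment from [- c] to [c], on which every
    ultrafilter converges. *)
Lemma ultra_bounded_cvg (UF : UltraFilter F) (z : I -> R[i]^o) (c : R) :
  (forall i, `|z i| <= c%:C) -> exists l : R[i]^o, z i @[i --> F] --> l.
Proof.
move=> zc.
have real_cvg (a : I -> R) : (forall i, `|a i| <= c) -> exists l : R, a i @[i --> F] --> l.
  move=> ac; have /= := @segment_compact R (- c) c.
  rewrite compact_ultra => /(_ (a i @[i --> F]) (ultra_fmap _ UF)).
  case=> [|l [_ al]]; last by exists l.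
  have : \forall i \near F, `[- c, c]%classic (a i).
    by apply: filterE => i; rewrite /= in_itv /= -ler_norml.
  by [].
have [|a za] := real_cvg (fun i => complex.Re (z i)).
  by move=> i; rewrite -lecR (le_trans _ (zc i))// normc_ge_Re.
have [|b zb] := real_cvg (fun i => complex.Im (z i)).
  by move=> i; rewrite -lecR (le_trans _ (zc i))// normc_ge_Im.
exists (a%:C + 'i * b%:C).
rewrite (_ : z = fun i => (complex.Re (z i))%:C + 'i * (complex.Im (z i))%:C); last first.
  by apply/funext => i; rewrite {1}[z i]complexE.
apply: cvgD; first exact: cvg_real_complex.
by apply: cvgM; [exact: cvg_cst|exact: cvg_real_complex].
Qed.

End ComplexLimits.

(** * Bounded operators, adjoints and unitaries *)

Section Operators.
Variables (R : realType) (H K : hilbertType R).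
Implicit Types (T S : bop H K) (u : bop H K).

Lemma bop_linear T : linear T.
Proof. by have /asboolP[] := bop_subproof T. Qed.

Lemma bop_bounded T : exists2 c : R, 0 <= c & forall x, `|T x| <= c%:C * `|x|.
Proof.
have /asboolP[_ [c Tc]] := bop_subproof T; exists `|c| => // x.
by rewrite (le_trans (Tc x))// ler_wpM2r// lecR ler_norm.
Qed.

Lemma innerC (L : hilbertType R) (x y : L) : inner x y = Num.conj (inner y x).
Proof. by rewrite hermC /= expr0 mul1r. Qed.

Lemma bopP T S : (forall x y, inner (T x) y = inner (S x) y) -> T = S.
Proof.
move=> TS; apply/val_inj/funext => x; apply: inner_ext => y.
by rewrite innerC [RHS]innerC TS.
Qed.

Lemma adjEr T x y : inner (adj T y) x = inner y (T x).
Proof. by rewrite innerC -adjE -innerC. Qed.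

(** [opnorm] is a supremum over the closed unit ball: a nonzero [x] is rescaled into the ball, and
    boundedness of [T] makes the supremum an upper bound. *)
Lemma opnormP T x : `|T x| <= (opnorm T)%:C * `|x|.
Proof.
have [c c0 Tc] := bop_bounded T.
have [->|x0] := eqVneq x 0.
  by rewrite (le_trans (Tc 0))// normr0 !mulr0.
have nx0 : 0 < `|x| by rewrite normr_gt0.
have TZ a y : T (a *: y) = a *: T y.
  have T0 : T 0 = 0 by apply/eqP; rewrite -normr_le0 (le_trans (Tc 0))// normr0 mulr0.
  by rewrite -[a *: y]addr0 bop_linear T0 addr0.
rewrite -ler_pdivrMr// mulrC.
have -> : `|x|^-1 * `|T x| = `|T (`|x|^-1 *: x)|.
  by rewrite TZ normrZ ger0_norm ?invr_ge0.
have normE y : `|T y| = (complex.Re `|T y|)%:C by rewrite RRe_real ?normr_real.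
rewrite normE lecR; apply: ub_le_sup.
  exists c => _ [y /= y1 <-]; rewrite -lecR -normE (le_trans (Tc y))//.
  by rewrite ler_piMr// lecR.
exists (`|x|^-1 *: x) => //=.
by rewrite normrZ ger0_norm ?invr_ge0// mulVf// gt_eqF.
Qed.

Lemma unitary_inner u x y : unitary u -> inner (u x) (u y) = inner x y.
Proof. by move=> [uu _]; rewrite adjE -[adj u (u y)]/((adj u *o u) y) uu. Qed.

Lemma unitary_norm u x : unitary u -> `|u x| = `|x|.
Proof.
move=> uu; apply/eqP; rewrite -(@eqrXn2 _ 2)//.
by rewrite -!inner_norm unitary_inner.
Qed.

Lemma unitary_adjK u y : unitary u -> u (adj u y) = y.
Proof. by move=> [_ uu]; rewrite -[LHS]/((u *o adj u) y) uu. Qed.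

(** For fixed [x] the form is conjugate-linear in [y], so the Riesz theorem is applied to its
    conjugate; the representing vector is [S x]. *)
Lemma bounded_sesquilinear_bop (B : H -> K -> R[i]) (c : R) :
  (forall a x x' y, B (a *: x + x') y = a * B x y + B x' y) ->
  (forall a x y y', B x (a *: y + y') = Num.conj a * B x y + B x y') ->
  (forall x y, `|B x y| <= c%:C * `|x| * `|y|) ->
  exists S : bop H K, forall x y, B x y = inner (S x) y.
Proof.
move=> Bl Br Bc.
have /choice[S SE] x : exists z, forall y, Num.conj (B x y) = inner y z.
  apply: (@Riesz_representation _ _ (fun y => Num.conj (B x y))
    (c * complex.Re `|x|)) => [a y y'|y].
    by rewrite Br rmorphD rmorphM /= conjCK.
  by rewrite norm_conjC rmorphM -[X in _ <= X * _]/(c%:C * (complex.Re `|x|)%:C) RRe_real ?normr_real.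
have {}SE x y : B x y = inner (S x) y by rewrite innerC -SE conjCK.
suff bS : bounded_linear_pred S by exists (Bop bS).
apply/asboolP; split=> [a x x'|].
  apply: inner_ext => y.
  rewrite innerC [RHS]innerC; congr Num.conj.
  by rewrite linearDl linearZl_LR /= -!SE Bl.
exists `|c| => x; have [->|Sx0] := eqVneq (S x) 0.
  by rewrite normr0 mulr_ge0// lecR.
(* Taking [y = S x] bounds the square of the norm of [S x] by [c] times the norms of [x] and [S x];
   the last factor cancels. *)
rewrite -(@ler_pM2r _ `|S x|) ?normr_gt0// -expr2 -inner_norm -SE.
rewrite (le_trans (real_ler_norm _)) ?ger0_real ?SE ?dnorm_ge0// -SE.
by rewrite (le_trans (Bc _ _))// -!mulrA ler_wpM2r ?mulr_ge0// lecR ler_norm.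
Qed.

End Operators.

Lemma adj_adj (R : realType) (H K : hilbertType R) (u : bop H K) : adj (adj u) = u.
Proof. by apply: bopP => x y; rewrite adjEr adjE. Qed.

Lemma unitary_adj (R : realType) (H K : hilbertType R) (u : bop H K) :
  unitary u -> unitary (adj u).
Proof. by move=> [uu uu']; split; rewrite adj_adj. Qed.

Lemma adj_comp (R : realType) (H K L : hilbertType R) (u : bop K L) (v : bop H K) :
  adj (u *o v) = adj v *o adj u.
Proof. by apply: bopP => x y; rewrite adjEr /= !adjEr. Qed.

Lemma unitary_comp (R : realType) (H K L : hilbertType R) (u : bop K L) (v : bop H K) :
  unitary u -> unitary v -> unitary (u *o v).
Proof.
move=> uu uv; split; apply: bopP => x y; first by rewrite adjEr /= !unitary_inner.
by rewrite adj_comp /= !unitary_adjK.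
Qed.

(** * Limits in the weak operator topology *)

Section WeakLimits.
Variables (R : realType) (I : Type) (F : set_system I).

(** In [R[i]] nonnegativity means a zero imaginary part and a nonnegative real part; each is checked
    up to every [e > 0]. *)
Lemma cvg_complex_ge0 {FF : ProperFilter F} (z : I -> R[i]^o) (l : R[i]^o) :
  (forall i, 0 <= z i) -> z i @[i --> F] --> l -> 0 <= l.
Proof.
move=> z0 zl.
have lz (e : R) : 0 < e -> exists i, `|l - z i| < e%:C.
  move=> e0; have e0' : (0 : R[i]) < e%:C by rewrite ltcR.
  move/cvgrPdist_lt: zl => /(_ _ e0') zl.
  by have [i ?] := filter_ex zl; exists i.
rewrite lecE /=; apply/andP; split.
  rewrite -normr_le0; apply/ler_addgt0Pr => e e0; rewrite add0r.
  have [i li] := lz _ e0; rewrite -lecR (le_trans _ (ltW li))//.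
  have /andP[/eqP zi _] : (complex.Im (z i) == 0) && (0 <= complex.Re (z i)).
    by have := z0 i; rewrite lecE.
  have -> : complex.Im l = complex.Im (l - z i) by rewrite raddfB /= zi subr0.
  exact: normc_ge_Im.
apply/ler_addgt0Pr => e e0.
have [i li] := lz _ e0.
have /andP[_ zi] : (complex.Im (z i) == 0) && (0 <= complex.Re (z i)).
  by have := z0 i; rewrite lecE.
have : `|complex.Re (l - z i)| <= e.
  by rewrite -lecR (le_trans _ (ltW li))// normc_ge_Re.
rewrite raddfB /= ler_norml => /andP[+ _].
rewrite lerBrDl => h; rewrite -(lerD2r (- e)) addrK add0r.
by apply: le_trans h; rewrite lerDr.
Qed.

(** This is the WOT-compactness of balls: every matrix coefficient converges along the ultrafilter,
    and the limits form a bounded sesquilinear form. *)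
Lemma wot_ultra_limit (UF : UltraFilter F) (H K : hilbertType R)
    (T : I -> bop H K) (c : R) :
  (forall i x, `|T i x| <= c%:C * `|x|) ->
  exists S : bop H K, forall x y,
    (inner (T i x) y : R[i]^o) @[i --> F] --> (inner (S x) y : R[i]^o).
Proof.
move=> Tc.
have TB i x y : `|inner (T i x) y| <= c%:C * `|x| * `|y|.
  by rewrite (le_trans (Cauchy_Schwarz _ _))// ler_wpM2r.
have /choice[B BE] (p : H * K) : exists l : R[i]^o,
    (inner (T i p.1) p.2 : R[i]^o) @[i --> F] --> l.
  apply: (@ultra_bounded_cvg _ _ _ _ _ (c * complex.Re `|p.1| * complex.Re `|p.2|)) => i.
  rewrite 2!rmorphM /= -[X in _ <= _ * X * _]/((complex.Re `|p.1|)%:C).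
  rewrite -[X in _ <= _ * X]/((complex.Re `|p.2|)%:C).
  by rewrite !RRe_real ?normr_real//; exact: TB.
have [|||S SE] := @bounded_sesquilinear_bop R H K (fun x y => B (x, y)) c.
- move=> a x x' y; apply: (cvg_complex_unique (BE (_, _))) => /=.
  rewrite (_ : (fun i => _) =
    fun i => (a : R[i]^o) * inner (T i x) y + inner (T i x') y).
    apply: cvgD; last exact: (BE (_, _)).
    by apply: cvgM; [exact: cvg_cst|exact: (BE (_, _))].
  by apply/funext => i; rewrite bop_linear linearDl linearZl_LR.
- move=> a x y y'; apply: (cvg_complex_unique (BE (_, _))) => /=.
  rewrite (_ : (fun i => _) =
    fun i => (Num.conj a : R[i]^o) * inner (T i x) y + inner (T i x) y').
    apply: cvgD; last exact: (BE (_, _)).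
    by apply: cvgM; [exact: cvg_cst|exact: (BE (_, _))].
  by apply/funext => i; rewrite linearDr linearZr_LR.
(* The bound passes to the limit as the nonnegativity of a difference. *)
- move=> x y; rewrite -subr_ge0.
  apply: (@cvg_complex_ge0 _ (fun i => c%:C * `|x| * `|y| - `|inner (T i x) y|)).
    by move=> i; rewrite subr_ge0.
  apply: cvgB; first exact: cvg_cst.
  by apply: cvg_norm; exact: (BE (_, _)).
by exists S => x y; rewrite -SE; exact: (BE (_, _)).
Qed.

(** Linearity, positivity of a matrix at given vectors and the value at [bid H] each involve
    finitely many matrix coefficients, hence survive pointwise weak limits. *)
Lemma ucp_wot_limit {FF : ProperFilter F} (H K : hilbertType R) (A : set 'B(H))
    (f : I -> 'B(H) -> 'B(K)) (g : 'B(H) -> 'B(K)) :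
  (forall i, ucp A (f i)) ->
  (forall T x y,
    (inner (f i T x) y : R[i]^o) @[i --> F] --> (inner (g T x) y : R[i]^o)) ->
  ucp A g.
Proof.
move=> fA fg.
split.
- move=> a S T AS AT; apply: bopP => x y.
  apply: (cvg_complex_unique (fg _ _ _)).
  rewrite -[X in _ --> X]/(inner (a *: g S x + g T x) y).
  rewrite linearDl linearZl_LR /=.
  rewrite (_ : (fun i => _) =
    fun i => (a : R[i]^o) * inner (f i S x) y + inner (f i T x) y).
    by apply: cvgD => //; apply: cvgM => //; exact: cvg_cst.
  apply/funext => i; have [-> // _ _] := fA i.
  by rewrite -linearZl_LR -linearDl.
- move=> n a Aa a0 x.
  apply: (@cvg_complex_ge0 _
    (fun i => \sum_(j < n) \sum_(k < n) inner (map_mx (f i) a j k (x k)) (x j))).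
    by move=> i; have [_ fi _] := fA i; exact: fi.
  apply: (@cvg_big R[i]^o _ _ _ _ add_continuous) => j _.
  apply: (@cvg_big R[i]^o _ _ _ _ add_continuous) => k _.
  by rewrite mxE; under eq_fun do rewrite mxE; exact: fg.
- apply: bopP => x y; apply: (cvg_complex_unique (fg _ _ _)).
  rewrite (_ : (fun i => _) = fun=> inner (bid K x) y); first exact: cvg_cst.
  by apply/funext => i; have [_ _ ->] := fA i.
Qed.

End WeakLimits.

(** The quadratic form of the conjugated map at [x] is that of [f] at the vectors [u (x i)]. *)
Lemma ucp_conj (R : realType) (H K L : hilbertType R) (A : set 'B(H))
    (f : 'B(H) -> 'B(K)) (u : bop L K) :
  unitary u -> ucp A f -> ucp A (fun T => adj u *o f T *o u).
Proof.
move=> uu [flin fcp f1]; split.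
- move=> a S T AS AT; rewrite flin//; apply: bopP => x y.
  by rewrite /= bop_linear.
- move=> n a Aa a0 x; have := fcp n a Aa a0 (fun i => u (x i)).
  congr (0 <= _); apply: eq_bigr => i _; apply: eq_bigr => j _.
  by rewrite !mxE /= adjEr.
- by rewrite f1; apply: bopP => x y; rewrite /= adjEr unitary_inner.
Qed.

(** * Closures of unitary orbits *)

Section WotApprox.
Variables (R : realType) (H : hilbertType R) (A : set 'B(H)).

(* [g] lies in the closure of the unitary orbit of [f] for the topology of
   pointwise WOT-convergence on [A]. *)
Definition wot_approx (K L : hilbertType R) (f : 'B(H) -> 'B(K)) (g : 'B(H) -> 'B(L)) : Prop :=
  forall (s : seq ('B(H) * (L * L))) (e : R[i]), 0 < e ->
    exists2 u : bop L K, unitary u & forall z, z \in s -> A z.1 ->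
      `|inner (g z.1 z.2.1) z.2.2 - inner (f z.1 (u z.2.1)) (u z.2.2)| < e.

Lemma wot_approx_trans (K L P : hilbertType R) (f : 'B(H) -> 'B(K))
    (g : 'B(H) -> 'B(L)) (h : 'B(H) -> 'B(P)) :
  wot_approx f g -> wot_approx g h -> wot_approx f h.
Proof.
move=> fg gh s e e0; have e20 : 0 < e / 2 by rewrite divr_gt0.
have [v uv vs] := gh s _ e20.
(* The test vectors are carried by [v] to the space of [g], where [f] approximates [g]. *)
have [u uu us] := fg [seq (z.1, (v z.2.1, v z.2.2)) | z <- s] _ e20.
exists (u *o v); first exact: unitary_comp.
move=> z sz Az; have /us/(_ Az)/= uz := map_f (fun z => (z.1, (v z.2.1, v z.2.2))) sz.
rewrite [e]splitr -(subrKA (inner (g z.1 (v z.2.1)) (v z.2.2))).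
by rewrite (le_lt_trans (ler_normD _ _))// ltrD// vs.
Qed.

Lemma cvg_wot_approx (K L : hilbertType R) (f : 'B(H) -> 'B(K))
    (g : 'B(H) -> 'B(L)) (I : Type) (F : set_system I) (u : I -> bop L K) :
  ProperFilter F -> (forall i, unitary (u i)) ->
  (forall T x y, A T -> (inner (f T (u i x)) (u i y) : R[i]^o) @[i --> F] -->
    (inner (g T x) y : R[i]^o)) ->
  wot_approx f g.
Proof.
move=> FF uu fg s e e0.
have : \forall i \near F, forall z, z \in s -> A z.1 ->
    `|inner (g z.1 z.2.1) z.2.2 - inner (f z.1 (u i z.2.1)) (u i z.2.2)| < e.
  apply: filter_near_seq => z _.
  have [Az|nAz] := pselect (A z.1); last by apply: filterE.
  by move/cvgrPdist_lt: (fg _ z.2.1 z.2.2 Az) => /(_ _ e0); apply: filterS.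
by move=> /filter_ex[i ui]; exists (u i).
Qed.

(** The net is indexed by the basic neighbourhoods themselves: finite lists of tests paired with a
    tolerance, ordered by refinement. *)
Lemma wot_approx_net (K L : hilbertType R) (f : 'B(H) -> 'B(K)) (g : 'B(H) -> 'B(L)) :
  wot_approx f g ->
  exists (I : Type) (le : I -> I -> Prop) (u : I -> bop L K),
    [/\ directed le, forall i, unitary (u i) &
        forall T, A T -> wot_cvg le (fun i => adj (u i) *o f T *o u i) (g T)].
Proof.
move=> fg; pose I := (seq ('B(H) * (L * L)) * {e : R[i] | 0 < e})%type.
have /choice[u uP] (p : I) :
    exists u : bop L K, unitary u /\ forall z, z \in p.1 -> A z.1 ->
      `|inner (g z.1 z.2.1) z.2.2 - inner (f z.1 (u z.2.1)) (u z.2.2)| < val p.2.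
  by have [u uu us] := fg p.1 _ (valP p.2); exists u.
pose le (p q : I) := {subset p.1 <= q.1} /\ val q.2 <= val p.2.
have dir_le : directed le.
  split=> [|p|p q r [pq qp] [qr rq]|p q].
  - by constructor; exact: ([::], exist (fun e : R[i] => 0 < e) 1 ltr01).
  - by split.
  - by split; [move=> z /pq /qr|exact: le_trans qp].
  - have [p0 q0] := (valP p.2, valP q.2).
    have pq0 : 0 < Num.min (val p.2) (val q.2) by rewrite /Num.min; case: ifP.
    (* The order of [R[i]] is partial, but positive elements are real and hence comparable. *)
    have pq_comp : (val p.2 >=< val q.2)%O by rewrite real_comparable// gtr0_real.
    exists (p.1 ++ q.1, exist (fun e : R[i] => 0 < e) _ pq0); split=> /=.
    + by move=> z pz; rewrite mem_cat pz.
    + by rewrite comparable_ge_min ?lexx.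
    + by move=> z qz; rewrite mem_cat qz orbT.
    + by rewrite comparable_ge_min ?lexx ?orbT.
have PF := tails_proper_filter dir_le.
exists I, le, u; split=> // [p|T AT x y]; first by have [] := uP p.
apply/cvgrPdist_lt => e e0.
exists ([:: (T, (x, y))], exist (fun e : R[i] => 0 < e) e e0) => q [/= Tq qe].
have [_ /(_ (T, (x, y)))/= uq] := uP q.
by rewrite adjEr (lt_le_trans _ qe)// uq// Tq// mem_head.
Qed.

End WotApprox.

(** * Transfer of the property from [pi] to [sigma] *)

Lemma inner_conj_opnorm (R : realType) (K L : hilbertType R) (u : bop L K)
    (S : 'B(K)) (T : 'B(L)) x y :
  `|inner (S (u x)) (u y) - inner (T x) y| <= (opnorm (adj u *o S *o u - T))%:C * (`|x| * `|y|).
Proof.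
have -> : inner (S (u x)) (u y) - inner (T x) y = inner ((adj u *o S *o u - T) x) y.
  by rewrite -[RHS]/(inner (adj u (S (u x)) - T x) y) linearBl /= adjEr.
by rewrite (le_trans (Cauchy_Schwarz _ _))// mulrA ler_wpM2r// opnormP.
Qed.

Theorem proposition3p5 (R : realType) (H Hpi Hsigma : hilbertType R)
    (M : set 'B(H)) (pi : 'B(H) -> 'B(Hpi)) (sigma : 'B(H) -> 'B(Hsigma)) :
  unital_operator_space M ->
  star_representation (cstar M) pi ->
  approx_unique_extension M pi ->
  star_representation (cstar M) sigma ->
  approx_unitarily_equivalent (cstar M) pi sigma ->
  approx_unique_extension M sigma.
Proof.
move=> _ _ piM _ [I [le [u [dirI uu piu]]]] psi psi_ucp psiM.
have PF := tails_proper_filter dirI.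
have [U [UU leU]] := ultraFilterLemma PF.
have subM : M `<=` cstar M by exact: sub_smallest.
(* [u i] goes from [Hsigma] to [Hpi], whereas bringing [psi] to [Hpi] calls for unitaries in the
   other direction. *)
pose v i := adj (u i).
have uv i : unitary (v i) by exact: unitary_adj.
have /choice[phi phiE] (T : 'B(H)) : exists S : 'B(Hpi), forall x y,
    (inner ((adj (v i) *o psi T *o v i) x) y : R[i]^o) @[i --> U] -->
    (inner (S x) y : R[i]^o).
  have [c c0 Tc] := bop_bounded (psi T).
  (* Unitary conjugation preserves the bound [c] of [psi T], so it is uniform in [i]. *)
  apply: (@wot_ultra_limit _ _ _ _ _ _ _ c) => i x /=.
  by rewrite unitary_norm ?(le_trans (Tc _)) ?unitary_norm//; exact: unitary_adj.
have phi_ucp : ucp (cstar M) phi.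
  by apply: (ucp_wot_limit _ phiE) => i; exact: ucp_conj.
have phiM T : M T -> phi T = pi T.
  move=> MT; apply: bopP => x y.
  apply: (cvg_complex_unique (phiE T x y)).
  apply: (@cvg_dist_real _ _ _ _
    (fun i => opnorm (adj (u i) *o pi T *o u i - sigma T)) _ _ (`|x| * `|y|)).
  - by rewrite mulr_ge0.
  - move=> i; rewrite psiM//= adjEr.
    (* On [M], [psi] is [sigma]. At [v i x] and [v i y] the estimate compares [pi T] at [x] and [y]
       with the conjugate of [sigma T], as [u i] undoes [v i]. *)
    have := inner_conj_opnorm (u i) (pi T) (sigma T) (v i x) (v i y).
    by rewrite /v !unitary_adjK// !unitary_norm//; exact: uv.
  (* [U] refines the filter of tails, so a limit of the net is a limit along [U]. *)
  - by move=> P /(piu T (subM _ MT))/leU.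
have [J [leJ [w [dirJ uw piw]]]] := piM phi phi_ucp phiM.
have approx_psi_phi : wot_approx (cstar M) psi phi.
  apply: (cvg_wot_approx ultra_proper uv) => T x y _.
  by under eq_fun do rewrite -adjEr; exact: phiE.
have approx_phi_pi : wot_approx (cstar M) phi pi.
  apply: (cvg_wot_approx (tails_proper_filter dirJ) uw) => T x y /piw/(_ x y).
  by under eq_fun do rewrite /= adjEr.
have approx_pi_sigma : wot_approx (cstar M) pi sigma.
  apply: (cvg_wot_approx PF uu) => T x y AT.
  apply: (@cvg_dist_real _ _ _ _
    (fun i => opnorm (adj (u i) *o pi T *o u i - sigma T)) _ _ (`|x| * `|y|)).
  - by rewrite mulr_ge0.
  - by move=> i; rewrite distrC inner_conj_opnorm.
  - exact: piu.
(* It remains to chain [psi], [phi], [pi] and [sigma]; only then is a net extracted. *)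
apply: wot_approx_net.
apply: wot_approx_trans approx_pi_sigma.
exact: wot_approx_trans approx_phi_pi.
Qed.
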